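(* Let $\kappa>0$ and suppose that a convex domain $\mathcal K\subset\mathbb R^2$ has boundary $\partial\mathcal K=\sigma$ a $\kappa$-constrained loop. Then $\mathcal K$ is rolling.
   Context: Put $r=1/\kappa$. A planar domain is an open connected subset of $\mathbb R^2$; $cl$ and ${}^c$ denote closure and complement. A loop $\sigma:S^1\to\mathbb R^2$ is a homeomorphic image of the circle (so it is simple), of class $C^1$, regular, arc length parametrised, traversed clockwise, with period equal to its length. A loop is $\kappa$-constrained if it is of class piecewise $C^2$ and $\|\sigma''\|\le\kappa$ wherever $\sigma''$ is defined. Let $T(t)$ be the tangent line to $\sigma$ at $\sigma(t)$. A domain $\mathcal K$ with $\partial\mathcal K=\sigma$ a $\kappa$-constrained loop is internal rolling if for all $t\in S^1$ there exists a disk $D(t)$ of radius $r$ tangent to $T(t)$ at $\sigma(t)$ with $D(t)\subset cl(\mathcal K)$. It is external rolling if for all $t\in S^1$ there exists a disk $E(t)$ of radius $r$ tangent to $T(t)$ at $\sigma(t)$ with $E(t)\subset cl(\mathcal K^c)$. It is rolling if it is both internal and external rolling. *)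

(* Defs.v *)
From HB Require Import structures.
From mathcomp Require Import all_boot all_order all_algebra.
From mathcomp Require Import all_classical all_reals all_analysis.

Set Implicit Arguments.
Unset Strict Implicit.
Unset Printing Implicit Defensive.

Import Order.TTheory GRing.Theory Num.Theory.
Import numFieldNormedType.Exports.

Local Open Scope classical_set_scope.
Local Open Scope ring_scope.

(* The plane is the normed space R * R.  Its library norm is the sup norm: it
   gives the usual topology and derivatives, but lengths, curvatures and disks
   are Euclidean and are measured with [enorm]. *)

Section Plane.
Context {R : realType}.
Implicit Types (p q c v : R * R) (K : set (R * R)).

Definition enorm v : R := Num.sqrt (v.1 ^+ 2 + v.2 ^+ 2).

Definition disk c (r : R) : set (R * R) := [set q | enorm (q - c) <= r].

Definition line p v : set (R * R) := range (fun u : R => p + u *: v).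

(* A line is tangent to a disk at [p] when [p] is their only common point. *)
Definition disk_tangent_at (D l : set (R * R)) p := D `&` l = [set p].

Definition boundary K := closure K `\` interior K.

Definition planar_domain K := open K /\ connected K.

End Plane.

Section Loop.
Context {R : realType}.
Implicit Types (kappa L : R) (sigma : R -> R * R) (K : set (R * R)).

Definition winding_number sigma L (p : R * R) (k : int) :=
  exists theta : R -> R,
    [/\ {within `[0, L], continuous theta},
        forall t, t \in `[0, L] ->
          sigma t = p + enorm (sigma t - p) *: (cos (theta t), sin (theta t)) &
        theta L = theta 0 + k%:~R * (2 * pi)].

Definition encloses sigma (p : R * R) :=
  ~ range sigma p /\ bounded_set (connected_component (~` range sigma) p).

Definition clockwise sigma L :=
  forall p, encloses sigma p -> winding_number sigma L p (-1).

(* A map from the circle is an L-periodic map from R.  Unit speed implies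
   regularity and makes the period L the length of the curve; injectivity on a
   period makes sigma a homeomorphism from the (compact) circle R/LZ onto its
   image. *)
Record loop sigma L : Prop := Loop {
  loop_period_gt0 : 0 < L ;
  loop_periodic : forall t, sigma (t + L) = sigma t ;
  loop_simple : {in `[0, L[ &, injective sigma} ;
  loop_derivable : forall t, derivable sigma t 1 ;
  loop_C1 : continuous (derive1 sigma) ;
  loop_arc_length : forall t, enorm (derive1 sigma t) = 1 ;
  loop_clockwise : clockwise sigma L }.

(* C^2 up to the end points: the one-sided limits of the second derivative
   exist there. *)
Definition C2_on (f : R -> R * R) (a b : R) :=
  [/\ {within `[a, b], continuous f},
      {in `]a, b[, forall t, derivable f t 1 /\ derivable (derive1 f) t 1},
      {in `]a, b[, continuous (derive1n 2 f)},
      cvg (derive1n 2 f t @[t --> a^'+]) &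
      cvg (derive1n 2 f t @[t --> b^'-])].

Definition piecewise_C2 (f : R -> R * R) (a b : R) :=
  exists2 s : seq R, itv_partition a b s &
    forall i, (i < size s)%N -> C2_on f (nth b (a :: s) i) (nth b s i).

Definition constrained_loop kappa sigma L :=
  [/\ loop sigma L, piecewise_C2 sigma 0 L &
      forall t, derivable (derive1 sigma) t 1 -> enorm (derive1n 2 sigma t) <= kappa].

Definition tangent_line sigma (t : R) := line (sigma t) (derive1 sigma t).

Definition internal_rolling kappa sigma K :=
  forall t, exists c, let D := disk c kappa^-1 in
    disk_tangent_at D (tangent_line sigma t) (sigma t) /\ D `<=` closure K.

Definition external_rolling kappa sigma K :=
  forall t, exists c, let E := disk c kappa^-1 in
    disk_tangent_at E (tangent_line sigma t) (sigma t) /\ E `<=` closure (~` K).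

Definition rolling kappa sigma K :=
  internal_rolling kappa sigma K /\ external_rolling kappa sigma K.

End Loop.

(* Main.v *)
Require Import Defs.
From mathcomp Require Import all_boot all_order all_algebra.
From mathcomp Require Import all_classical all_reals all_analysis.
From mathcomp Require Import ring lra.
Import Order.TTheory GRing.Theory Num.Theory.
Import numFieldNormedType.Exports.

Local Open Scope classical_set_scope.
Local Open Scope ring_scope.

Set Implicit Arguments.
Unset Strict Implicit.
Unset Printing Implicit Defensive.

(** Write [T] for the unit tangent, [k] for the curvature measured towards [K],
    and [r] for [1 / kappa].  The closure of a convex domain with a [C^1]
    boundary curve is the intersection of the closed half-planes cut out by the
    tangent lines ([inner_side], [closure_halfplane], [closure_of_halfplanes]).
    This gives the external disk at once: it lies across the tangent line.  It
    also reduces the internal disk at [sigma t] to inequalities between [s] and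
    [t]: the disk of radius [r] whose centre is [sigma t] moved by [r] along the
    inner normal lies in the half-plane at [s] exactly when the height of
    [sigma t] above the tangent line at [s] is at least
    [r * (1 - T s . T t)] ([support_chord]).

    Fix [s] and regard three functions of [t]: the height [g] of [sigma t] above
    the tangent line at [s], the component [phi] of [T t] along the inner normal
    at [s], and [psi = T s . T t].  Then [g' = phi], [phi' = k psi],
    [psi' = - k phi], and [0 <= k <= kappa]: convexity gives the lower bound
    ([curvature_ge0]), the constraint on the loop gives the upper one.  For a
    radius [r' < r] the function [G = g - r' (1 - psi)] is the height of the
    inner parallel curve, and [G' = (1 - r' k) phi] has the sign of [phi].
    Suppose that [G] is negative somewhere on a period starting at [s], and let
    [t0] be its last minimizer there.  If [phi t0 > 0], then [G] is smaller just
    before [t0].  If [phi t0 < 0], then [G] does not increase just after [t0],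
    against the choice of the last minimizer.  If [phi t0 = 0], then
    [psi t0 = 1] or [psi t0 = -1]; the first is impossible because
    [G t0 = g t0 >= 0]; in the second case [phi' = k psi <= 0] near [t0], so that
    [phi <= 0] just after [t0] and again [G] does not increase there.  Hence
    [G >= 0] ([parallel_support_ge0]), and letting [r'] tend to [r] ends the
    proof ([support_ge_chord]). *)

(** * Functions of one real variable *)
Section RealFunctions.
Context {R : realType}.
Implicit Types (f : R -> R) (s : seq R).

(** The tangent of a piecewise [C^2] curve is continuous but fails to be
    differentiable at break points, so monotonicity has to be read from
    derivatives that may be missing at finitely many points. *)
Lemma ndecr_off_finite f s a b : a <= b -> continuous f ->
  (forall x, a < x < b -> x \notin s ->
    exists2 d : R, is_derive x 1 f d & 0 <= d) ->
  f a <= f b.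
Proof.
move=> + cf; elim: s a b => [|p s IH] a b ab df.
  apply: (@ger0_derive1_ndecr _ f a b) => // [x|x|].
  - by rewrite in_itv/= => xab; have [//|d dfx _] := df x xab.
  - rewrite in_itv/= => xab; have [//|d dfx d0] := df x xab.
    by rewrite derive1E derive_val.
  - exact: continuous_subspaceT.
have [/andP[ap pb]|pab] := boolP (a < p < b).
  apply: (@le_trans _ _ (f p)); apply: IH => [|x /andP[ax xb] xs].
  - exact: ltW.
  - apply: df; first by rewrite ax (lt_trans xb).
    by rewrite inE negb_or xs lt_eqF.
  - exact: ltW.
  - apply: df; first by rewrite xb (lt_trans ap).
    by rewrite inE negb_or xs gt_eqF.
apply: IH => // x xab xs; apply: df => //.
by rewrite inE negb_or xs andbT; apply: contraNneq pab => <-.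
Qed.

Lemma continuous_gt_itv f (t z : R) : {for t, continuous f} -> z < f t ->
  exists2 e : R, 0 < e & forall x, `|x - t| < e -> z < f x.
Proof.
move=> cf zf; have /nbhs_ballP : \forall x \near t, z < f x by exact: (cvgr_gt _ cf _ zf).
move=> [e /= e0 He].
by exists e => // x xt; apply: He; rewrite /ball/= distrC.
Qed.

Lemma last_minimizer f (a b : R) : a <= b -> continuous f ->
  exists2 t, a <= t <= b &
    (forall x, a <= x <= b -> f t <= f x) /\
    (forall x, t < x <= b -> f t < f x).
Proof.
move=> ab cf.
have [c cab cmin] := EVT_min ab (continuous_subspaceT cf).
pose A := [set x | a <= x <= b /\ f x <= f c].
have Ac : A c by move: cab; rewrite in_itv.
have Aub : ubound A b by move=> x [/andP[]].
have clA : closed A.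
  have -> : A = [set x | a <= x] `&` [set x | x <= b] `&` f @^-1` [set y | y <= f c].
    apply/seteqP; split=> [x [/andP[ax xb] fx]|x [[ax xb] fx]]; first by [].
    by split; first exact/andP.
  apply: closedI; first by apply: closedI; [exact: closed_ge|exact: closed_le].
  by apply: closed_comp; [move=> x _; exact: cf|exact: closed_le].
have [tab tc] : A (sup A).
  suff : closure A (sup A) by rewrite -((closure_id A).1 clA).
  by apply: closure_sup; [exists c|exists b].
exists (sup A) => //; split=> [x xab|x /andP[tx xb]].
  by rewrite (le_trans tc)// cmin// in_itv.
rewrite ltNge; apply/negP => fx.
have : A x.
  split; last exact: le_trans fx tc.
  by case/andP: tab => at0 _; rewrite xb (le_trans at0 (ltW tx)).
by move/(ub_le_sup (ex_intro _ b Aub)); rewrite leNgt tx.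
Qed.

Lemma nonvanishing_sign f : continuous f -> (forall t, f t != 0) ->
  exists2 e : R, e ^+ 2 = 1 & forall t, 0 < e * f t.
Proof.
move=> cf f0; exists (Num.sg (f 0)).
  by rewrite sqr_sg f0.
move=> t; rewrite ltNge; apply/negP => ft.
have sgf : 0 < Num.sg (f 0) * f 0 by rewrite -normrEsg normr_gt0.
pose g := (Num.sg (f 0) *: f : R -> R).
have cg : continuous g by move=> x; apply: continuousZr; exact: cf.
have [c gc] : exists c, g c = 0.
  have [t0|t0] := leP 0 t.
    have [|c _ gc] := @IVT _ g 0 t 0 t0 (continuous_subspaceT cg); last by exists c.
    by rewrite ge_min le_max /g !fctE/= /GRing.scale/= ft (ltW sgf) orbT.
  have [|c _ gc] := @IVT _ g t 0 0 (ltW t0) (continuous_subspaceT cg); last by exists c.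
  by rewrite ge_min le_max /g !fctE/= /GRing.scale/= ft (ltW sgf) orbT.
move/eqP: gc; rewrite /g !fctE /GRing.scale/= mulf_eq0 sgr_eq0.
by rewrite (negbTE (f0 0)) (negbTE (f0 c)).
Qed.

End RealFunctions.

(** * The height of an inner parallel curve *)
Section ParallelHeight.
Context {R : realType}.
Variables (g phi psi k : R -> R) (s : seq R) (A B kappa : R).
Hypothesis kappa_gt0 : 0 < kappa.
Hypothesis cphi : continuous phi.
Hypothesis cpsi : continuous psi.
Hypothesis dg : forall t : R, is_derive t 1 g (phi t).
Hypothesis frenet : forall t : R, A < t < B -> t \notin s ->
  [/\ is_derive t 1 phi (k t * psi t), is_derive t 1 psi (- (k t * phi t)) &
      0 <= k t <= kappa].
Hypothesis unit_frame : forall t, phi t ^+ 2 + psi t ^+ 2 = 1.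
Hypothesis g_ge0 : forall t, 0 <= g t.
Hypothesis psiA : psi A = 1.
Hypothesis psiB : psi B = 1.

Let cg : continuous g.
Proof.
move=> t; apply: differentiable_continuous; apply/derivable1_diffP.
by have := dg t => -[].
Qed.

(** The comparison argument on one period.  The strict bound [r * kappa < 1]
    keeps [1 - r * k] away from zero, so that [G] really decreases backwards
    from a point where [phi] is positive. *)
Lemma parallel_support_ge0 (r t : R) : 0 < r -> r * kappa < 1 -> A <= t <= B ->
  r * (1 - psi t) <= g t.
Proof.
move=> r0 rk tAB; rewrite leNgt; apply/negP => gt.
pose G := (g - r *: (cst 1 - psi) : R -> R).
have GE u : G u = g u - r * (1 - psi u) by [].
have cG : continuous G.
  move=> u; apply: continuousB; first exact: cg.
  by apply: continuousZr; apply: continuousB; [exact: cst_continuous|exact: cpsi].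
have dG u : A < u < B -> u \notin s ->
    is_derive u 1 G ((1 - r * k u) * phi u) /\ 0 <= k u <= kappa.
  move=> uAB us; have [dphi dpsi ku] := frenet uAB us; split=> //.
  have ? := dg u; rewrite /G; apply: is_derive_eq.
  by rewrite /GRing.scale/=; ring.
have [t0 /andP[At0 t0B] [Gmin Glast]] : exists2 t, A <= t <= B &
    (forall x, A <= x <= B -> G t <= G x) /\ (forall x, t < x <= B -> G t < G x).
  by apply: last_minimizer => //; case/andP: tAB; exact: le_trans.
have Gt0 : G t0 < 0 by rewrite (le_lt_trans (Gmin t tAB))// GE subr_lt0.
have psi_neq1 : psi t0 <> 1.
  by move=> p1; move: Gt0; rewrite GE p1 subrr mulr0 subr0 ltNge g_ge0.
have {}At0 : A < t0.
  by rewrite lt_neqAle At0 andbT; apply/eqP => E; apply: psi_neq1; rewrite -E.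
have {}t0B : t0 < B.
  by rewrite lt_neqAle t0B andbT; apply/eqP => E; apply: psi_neq1; rewrite E.
(* phi <= 0 makes G nonincreasing, so the minimum would be attained again. *)
have right d : 0 < d -> ~ forall u, t0 <= u < t0 + d -> phi u <= 0.
  move=> d0 phi_le0; pose e := Num.min B (t0 + d).
  have te : t0 < e by rewrite lt_min t0B ltrDl.
  have eB : e <= B by rewrite ge_min lexx.
  have ed : e <= t0 + d by rewrite ge_min lexx orbT.
  suff : (- G) t0 <= (- G) e by rewrite lerN2 leNgt Glast// te.
  apply: (@ndecr_off_finite _ _ s) => [||u /andP[tu ue] us].
  - exact: ltW.
  - by move=> u; apply: continuousN; exact: cG.
  - have [|? /andP[k0 k1]] := dG u _ us; first by rewrite (lt_trans At0) ?(lt_le_trans ue).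
    exists (- ((1 - r * k u) * phi u)); first exact: is_deriveN.
    have phi0 : phi u <= 0 by apply: phi_le0; rewrite ltW//= (lt_le_trans ue).
    have rku : r * k u <= r * kappa by rewrite ler_pM2l.
    by rewrite oppr_ge0 mulr_ge0_le0//; lra.
have [phi_lt0|phi_gt0|phi0] := ltgtP (phi t0) 0.
- have [|e e0 He] := @continuous_gt_itv _ (- phi) t0 0 (continuousN (@cphi t0)).
    by rewrite oppr_gt0.
  apply: (right e e0) => u /andP[tu ue].
  have := He u; rewrite ger0_norm ?subr_ge0// ltrBlDl => /(_ ue).
  by rewrite oppr_gt0 => /ltW.
- have [|e e0 He] := @continuous_gt_itv _ phi t0 (phi t0 / 2) (@cphi t0).
    by lra.
  pose d := Num.max A (t0 - e / 2).
  have dt : d < t0 by rewrite gt_max At0/=; lra.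
  have Ad : A <= d by rewrite le_max lexx.
  have ed : t0 - e / 2 <= d by rewrite le_max lexx orbT.
  (* A lower bound for the slope of G near t0. *)
  pose c := (1 - r * kappa) * (phi t0 / 2).
  have c0 : 0 < c by rewrite mulr_gt0 ?subr_gt0// divr_gt0.
  have : (G - c *: id) d <= (G - c *: id) t0.
    apply: (@ndecr_off_finite _ _ s) => [||u /andP[du ut] us].
    + exact: ltW.
    + move=> u; apply: continuousB; first exact: cG.
      by apply: continuousZr; exact: cvg_id.
    + have [|? /andP[k0 k1]] := dG u _ us.
        by rewrite (le_lt_trans Ad) ?(lt_trans ut).
      exists ((1 - r * k u) * phi u - c *: 1); first exact: is_deriveB.
      have := He u; rewrite ltr0_norm ?subr_lt0// => /(_ _) phiu.
      have {}phiu : phi t0 / 2 < phi u by apply: phiu; lra.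
      rewrite [_ *: _]mulr1 subr_ge0 /c.
      apply: ler_pM; [lra|lra| |exact: ltW].
      by rewrite lerD2l lerN2 ler_pM2l.
  apply/negP; rewrite -ltNge.
  have := Gmin d; rewrite Ad (ltW (lt_trans dt t0B)) => /(_ isT) Gd.
  rewrite -subr_gt0; rewrite !fctE /GRing.scale /=.
  have : c * d < c * t0 by rewrite ltr_pM2l.
  lra.
- have psit0 : psi t0 = -1.
    have := unit_frame t0; rewrite phi0 expr0n add0r => /eqP.
    by rewrite sqrf_eq1 => /orP[/eqP//|/eqP].
  have [|e e0 He] := @continuous_gt_itv _ (- psi) t0 0 (continuousN (@cpsi t0)).
    by rewrite !fctE psit0 opprK.
  pose d := Num.min e (B - t0).
  have d0 : 0 < d by rewrite lt_min e0 subr_gt0.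
  have de : d <= e by rewrite ge_min lexx.
  have dB : d <= B - t0 by rewrite ge_min lexx orbT.
  apply: (right d d0) => u /andP[tu ud].
  suff : (- phi) t0 <= (- phi) u by rewrite !fctE phi0 oppr0 oppr_ge0.
  apply: (@ndecr_off_finite _ _ s) => [//||v /andP[tv vu] vs].
  + by move=> v; apply: continuousN; exact: cphi.
  + have [|? _ /andP[k0 k1]] := @frenet v _ vs; first by apply/andP; split; lra.
    exists (- (k v * psi v)); first exact: is_deriveN.
    have := He v; rewrite gtr0_norm ?subr_gt0// => Hv.
    have {Hv} : 0 < - psi v by apply: Hv; lra.
    nra.
Qed.

(** The limiting radius [1 / kappa]: a failure there is a failure for some
    smaller radius, namely one halfway between [g t / (1 - psi t)] and
    [1 / kappa]. *)
Lemma support_ge_chord t : A <= t <= B -> kappa^-1 * (1 - psi t) <= g t.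
Proof.
move=> tAB.
have psi_le1 : psi t <= 1 by have := unit_frame t; nra.
have [psi1|psi_neq1] := eqVneq (psi t) 1.
  by rewrite psi1 subrr mulr0 g_ge0.
have p0 : 0 < 1 - psi t by rewrite subr_gt0 lt_neqAle psi_neq1.
rewrite leNgt; apply/negP; rewrite -ltr_pdivrMr// => gt.
have ki0 : 0 < kappa^-1 by rewrite invr_gt0.
pose q := Num.max (g t / (1 - psi t)) 0.
have qk : q < kappa^-1 by rewrite gt_max gt.
have q0 : 0 <= q by rewrite le_max lexx orbT.
have gq : g t <= q * (1 - psi t) by rewrite -ler_pdivrMr// le_max lexx.
have := @parallel_support_ge0 ((q + kappa^-1) / 2) t.
rewrite -ltr_pdivlMr// div1r tAB => /(_ _ _ isT) H.
have {H} : (q + kappa^-1) / 2 * (1 - psi t) <= g t by apply: H; lra.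
apply/negP; rewrite -ltNge (le_lt_trans gq)// ltr_pM2r//; lra.
Qed.

End ParallelHeight.

(** * Segments in convex sets, coordinates, determinants *)
Section Convex.
Context {R : realType}.
Implicit Types (K : set (R * R)) (p q : R * R).

Lemma convex_set_segment K p q (l : R) : convex_set K -> K p -> K q -> 0 <= l <= 1 ->
  K (p + l *: (q - p)).
Proof.
move=> cK Kp Kq /andP[l0 l1].
have := cK q p (Itv01 l0 l1) (mem_set Kq) (mem_set Kp); rewrite inE.
rewrite -[X in K X]/(l *: q + (1 - l) *: p : R * R).
by congr K; rewrite scalerBl scale1r scalerBr addrCA.
Qed.

(** The point [p + l (q - p)] is also a convex combination of any [p'] and a
    point [f p'] which is close to [q] when [p'] is close to [p]; take [p'] in
    [K]. *)
Lemma closure_convex_segment K p q (l : R) : convex_set K -> open K ->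
  closure K p -> K q -> 0 < l <= 1 -> K (p + l *: (q - p)).
Proof.
move=> cK oK clp Kq /andP[l0 l1].
pose f p' := q + ((1 - l) / l) *: (p - p').
have cf : continuous f.
  move=> x; apply: cvgD; first exact: cvg_cst.
  by apply: cvgZr; apply: cvgB; [exact: cvg_cst|exact: cvg_id].
have [p' [Kp' Kfp']] : K `&` (f @^-1` K) !=set0.
  apply: clp; apply: cf; apply: open_nbhs_nbhs; split=> //.
  by rewrite /f subrr scaler0 addr0.
have := convex_set_segment (l := l) cK Kp' Kfp'; rewrite (ltW l0) l1 => /(_ isT).
congr K; rewrite /f addrAC scalerDr scalerA mulrCA mulfV ?gt_eqF// mulr1.
apply/eqP; rewrite -subr_eq0; apply/eqP.
by apply: injective_projections; rewrite /= /GRing.scale /=; ring.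
Qed.

End Convex.

Section Coordinates.
Context {R : realType}.

Lemma is_derive_fst (f : R -> R * R) (t : R) : derivable f t 1 ->
  is_derive t 1 (fst \o f) (derive1 f t).1.
Proof.
move=> df; have dc : h^-1 *: ((f \o shift t) (h *: 1) - f t) @[h --> 0^'] --> 'D_1 f t.
  exact: df.
have cc : h^-1 *: (((fst \o f) \o shift t) (h *: 1) - (fst \o f) t) @[h --> 0^'] --> ('D_1 f t).1.
  exact: (cvg_comp _ _ dc cvg_fst).
apply: DeriveDef; first by apply/cvg_ex; exists ('D_1 f t).1.
by rewrite derive1E; exact: (cvg_lim _ cc).
Qed.

Lemma is_derive_snd (f : R -> R * R) (t : R) : derivable f t 1 ->
  is_derive t 1 (snd \o f) (derive1 f t).2.
Proof.
move=> df; have dc : h^-1 *: ((f \o shift t) (h *: 1) - f t) @[h --> 0^'] --> 'D_1 f t.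
  exact: df.
have cc : h^-1 *: (((snd \o f) \o shift t) (h *: 1) - (snd \o f) t) @[h --> 0^'] --> ('D_1 f t).2.
  exact: (cvg_comp _ _ dc cvg_snd).
apply: DeriveDef; first by apply/cvg_ex; exists ('D_1 f t).2.
by rewrite derive1E; exact: (cvg_lim _ cc).
Qed.

End Coordinates.

(** For a unit vector [v], [det v (p - q)] is the signed height of [p] above
    the line through [q] with direction [v]. *)
Definition det {R : realType} (v w : R * R) : R := v.1 * w.2 - v.2 * w.1.

Lemma enorm_le {R : realType} (v : R * R) (r : R) : 0 <= r ->
  (enorm v <= r) = (v.1 ^+ 2 + v.2 ^+ 2 <= r ^+ 2).
Proof.
by move=> r0; rewrite -[in LHS](ger0_norm r0) -sqrtr_sqr ler_sqrt// sqr_ge0.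
Qed.

Section Det.
Context {R : realType}.

Lemma det_sub (v p q : R * R) : det v (p - q) = det v p - det v q.
Proof. by rewrite /det/=; ring. Qed.

(** A differentiable unit vector turns orthogonally to itself; the determinant
    is its angular speed.  The second hypothesis is the derivative of
    [a ^+ 2 + b ^+ 2] as the product rule writes it. *)
Lemma unit_vector_derivative (a b a' b' : R) : a ^+ 2 + b ^+ 2 = 1 ->
  a * a' + a * a' + (b * b' + b * b') = 0 ->
  a' = - ((a * b' - b * a') * b) /\ b' = (a * b' - b * a') * a.
Proof.
move=> u1 o1; have {}o1 : a * a' + b * b' = 0 by lra.
split; rewrite -[LHS]mulr1 -u1; apply/eqP; rewrite -subr_eq0; apply/eqP.
- by transitivity (a * (a * a' + b * b')); [ring|rewrite o1 mulr0].
- by transitivity (b * (a * a' + b * b')); [ring|rewrite o1 mulr0].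
Qed.

Lemma is_derive_det (v : R * R) (f : R -> R * R) (t : R) : derivable f t 1 ->
  is_derive t 1 (fun u => det v (f u)) (det v (derive1 f t)).
Proof.
move=> df; have d1 := is_derive_fst df; have d2 := is_derive_snd df.
have -> : (fun u => det v (f u)) = v.1 *: (snd \o f) - v.2 *: (fst \o f) by [].
exact: is_deriveB.
Qed.

Lemma det_continuous (v : R * R) (f : R -> R * R) : continuous f ->
  continuous (fun u => det v (f u)).
Proof.
move=> cf t; apply: cvgB; apply: cvgM; try exact: cvg_cst.
  by apply: (cvg_comp _ _ (cf t)); exact: cvg_snd.
by apply: (cvg_comp _ _ (cf t)); exact: cvg_fst.
Qed.

(** Cauchy-Schwarz, by the Lagrange identity. *)
Lemma det_bound (v w : R * R) (e r : R) : 0 <= r -> e ^+ 2 = 1 ->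
  v.1 ^+ 2 + v.2 ^+ 2 = 1 -> enorm w <= r -> `|e * det v w| <= r.
Proof.
move=> r0 e2 v1; rewrite enorm_le// => wr.
rewrite -ler_sqr ?nnegrE// real_normK ?num_real// exprMn e2 mul1r.
apply: le_trans wr; rewrite -[leRHS]mul1r -v1 /det.
have := sqr_ge0 (v.1 * w.1 + v.2 * w.2); lra.
Qed.

(** The centre lies on the normal to the line at [p], so Pythagoras separates
    [p] from every other point of the line. *)
Lemma disk_tangent (p v : R * R) (rho r : R) : 0 <= r -> rho ^+ 2 = r ^+ 2 ->
  v.1 ^+ 2 + v.2 ^+ 2 = 1 ->
  disk_tangent_at (disk (p + rho *: (- v.2, v.1)) r) (line p v) p.
Proof.
move=> r0 rho2 v1.
have E u : (p + u *: v \in disk (p + rho *: (- v.2, v.1)) r) = (u == 0).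
  rewrite -(sqrf_eq0 u) eq_le sqr_ge0 andbT; apply/idP/idP; rewrite inE /disk/= enorm_le//=.
  - rewrite /GRing.scale/= => H.
    suff : (u ^+ 2 + rho ^+ 2) * (v.1 ^+ 2 + v.2 ^+ 2) <= r ^+ 2 by rewrite v1 rho2; lra.
    by apply: le_trans H; rewrite le_eqVlt; apply/orP; left; apply/eqP; ring.
  - move=> u0; rewrite /GRing.scale/=.
    suff : (u ^+ 2 + rho ^+ 2) * (v.1 ^+ 2 + v.2 ^+ 2) <= r ^+ 2.
      by apply: le_trans; rewrite le_eqVlt; apply/orP; left; apply/eqP; ring.
    by rewrite v1 rho2; lra.
apply/seteqP; split=> [x [+ [u _ ux]]|x ->].
  by rewrite -ux => /mem_set; rewrite E => /eqP ->; rewrite scale0r addr0.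
split; last by exists 0 => //; rewrite scale0r addr0.
by have := E 0; rewrite scale0r addr0 eqxx => /set_mem.
Qed.

End Det.

(** * Tangent lines support the domain *)
Section Tangents.
Context {R : realType}.
Variables (K : set (R * R)) (sigma : R -> R * R).
Hypothesis oK : open K.
Hypothesis cK : convex_set K.
Hypothesis K_boundary : boundary K = range sigma.
Hypothesis dsigma : forall t : R, derivable sigma t 1.
Hypothesis unit_speed : forall t, (derive1 sigma t).1 ^+ 2 + (derive1 sigma t).2 ^+ 2 = 1.
Hypothesis csigma' : continuous (derive1 sigma).

Let T := derive1 sigma.

Lemma curve_closure t : closure K (sigma t).
Proof. by have [] : boundary K (sigma t) by rewrite K_boundary; exists t. Qed.

Lemma curve_notin t : ~ K (sigma t).
Proof.
have [_ nK] : boundary K (sigma t) by rewrite K_boundary; exists t.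
by rewrite (interior_id K).1// in nK.
Qed.

Lemma domain_nonempty : K !=set0.
Proof.
have [p [Kp _]] := @curve_closure 0 setT filterT; by exists p.
Qed.

(** If the tangent line met the open set [K] at [q], the secants through
    [sigma t] and a nearby point [sigma (t + h)] would meet [K] near [q] as well.
    Choosing [h] so that [sigma t] lies between [sigma (t + h)] and this point of
    [K] puts [sigma t] in [K]. *)
Lemma tangent_misses t u : ~ K (sigma t + u *: T t).
Proof.
move=> Kq; have dq := @dsigma t.
have cvq : h^-1 *: ((sigma \o shift t) (h *: 1) - sigma t) @[h --> 0^'] --> T t.
  by rewrite /T derive1E; exact: dq.
have : \forall h \near 0^', K (sigma t + u *: (h^-1 *: ((sigma \o shift t) (h *: 1) - sigma t))).
  have cvK : sigma t + u *: (h^-1 *: ((sigma \o shift t) (h *: 1) - sigma t)) @[h --> 0^'] --> sigma t + u *: T t.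
    by apply: cvgD; [exact: cvg_cst|apply: cvgZr].
  by apply: cvK; apply: open_nbhs_nbhs; split.
move=> /nbhs_ballP[e /= e0 He].
have [h [hne he uh]] : exists h : R, [/\ h != 0, `|h| < e & u / h <= 0].
  have [u0|u0] := leP 0 u.
    exists (- (e / 2)); split; first by lra.
      by rewrite normrN gtr0_norm; lra.
    by rewrite invrN mulrN oppr_le0 mulr_ge0// invr_ge0; lra.
  exists (e / 2); split; first by lra.
    by rewrite gtr0_norm; lra.
  by rewrite mulr_le0_ge0 ?(ltW u0)// invr_ge0; lra.
have {He} Kh : K (sigma t + u *: (h^-1 *: ((sigma \o shift t) (h *: 1) - sigma t))).
  by apply: He => //; rewrite /ball/= sub0r normrN.
have {Kh} Kh : K (sigma t + (u / h) *: (sigma (h + t) - sigma t)).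
  by move: Kh; rewrite scalerA /= [h *: 1]mulr1.
(* Seen from sigma (h + t), the point sigma t lies at the fraction
   1 / (1 - u / h) of the segment to that point of K. *)
have c1 : 0 < 1 - u / h by lra.
apply: (@curve_notin t).
have := closure_convex_segment (l := (1 - u / h)^-1) cK oK (@curve_closure (h + t)) Kh.
rewrite invr_gt0 c1/= invf_le1// => H.
have {}H := H _; rewrite -[X in K X](_ : sigma (h + t) + (1 - u / h)^-1 *: (sigma t + (u / h) *: (sigma (h + t) - sigma t) - sigma (h + t)) = _).
  by apply: H; lra.
set c := u / h in c1 *.
have c1n : 1 - c != 0 by rewrite gt_eqF.
by apply: injective_projections; rewrite /= /GRing.scale/=; field.
Qed.

Lemma det_derive_continuous p : continuous (fun t => det (T t) (p - sigma t)).
Proof.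
have cs : continuous sigma.
  by move=> t; apply: differentiable_continuous; apply/derivable1_diffP.
have c1 (f : R -> R * R) : continuous f -> continuous (fun t => (f t).1).
  by move=> cf t; apply: (cvg_comp _ _ (cf t)); exact: cvg_fst.
have c2 (f : R -> R * R) : continuous f -> continuous (fun t => (f t).2).
  by move=> cf t; apply: (cvg_comp _ _ (cf t)); exact: cvg_snd.
move=> t; apply: cvgB; apply: cvgM.
- exact: c1.
- by apply: cvgB; [exact: cvg_cst|exact: c2].
- exact: c2.
- by apply: cvgB; [exact: cvg_cst|exact: c1].
Qed.

(** The sign [e] tells on which side of its tangents the curve keeps [K]:
    [e * (- (T t).2, (T t).1)] is the inner unit normal.  It is constant along
    the curve by continuity, and on [K] by convexity, since a change of sign
    inside [K] would put a point of [K] on the tangent line. *)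
Lemma inner_side : exists2 e : R, e ^+ 2 = 1 &
  forall t p, K p -> 0 < e * det (T t) (p - sigma t).
Proof.
have on_line t p : det (T t) (p - sigma t) = 0 -> ~ K p.
  move=> d0 Kp; apply: (@tangent_misses t ((T t).1 * (p - sigma t).1 + (T t).2 * (p - sigma t).2)).
  have T1 : (T t).1 ^+ 2 + (T t).2 ^+ 2 = 1 by exact: unit_speed.
  suff -> : sigma t + ((T t).1 * (p - sigma t).1 + (T t).2 * (p - sigma t).2) *: T t = p.
    by [].
  move: d0 T1; rewrite /det /=.
  set a := (T t).1; set b := (T t).2 => /eqP; rewrite subr_eq0 => /eqP d0 T1.
  apply: injective_projections; rewrite /= /GRing.scale/= -/a -/b.
  - transitivity ((sigma t).1 + (a ^+ 2 + b ^+ 2) * (p.1 - (sigma t).1)).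
      by rewrite [(a ^+ 2 + _) * _]mulrDl -[b ^+ 2 * _]mulrA -d0; ring.
    by rewrite T1; ring.
  - transitivity ((sigma t).2 + (a ^+ 2 + b ^+ 2) * (p.2 - (sigma t).2)).
      by rewrite [(a ^+ 2 + _) * _]mulrDl -[a ^+ 2 * _]mulrA d0; ring.
    by rewrite T1; ring.
have [q Kq] := domain_nonempty.
have [|e e2 He] := nonvanishing_sign (@det_derive_continuous q).
  by move=> t; apply/eqP => /on_line.
exists e => // t p Kp; rewrite ltNge; apply/negP => ep.
have eo := He t.
set a := e * det _ _ in eo; set b := e * det _ _ in ep.
(* The height is affine from q to p, so it vanishes at the fraction
   a / (a - b) of the segment. *)
have ab : 0 < a - b by lra.
have := convex_set_segment (l := a / (a - b)) cK Kq Kp.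
have -> : 0 <= a / (a - b) <= 1.
  by rewrite divr_ge0 ?(ltW ab) ?(ltW eo)//= ler_pdivrMr// mul1r; lra.
move=> /(_ isT); apply: (on_line t).
have e0 : e != 0 by rewrite -sqrf_eq0 e2 oner_eq0.
have -> : det (T t) (q + a / (a - b) *: (p - q) - sigma t) =
    ((a - b) * (a / e) + a * (b / e - a / e)) / (a - b).
  have abn : a - b != 0 by rewrite gt_eqF.
  have -> : b / e = det (T t) (p - sigma t) by rewrite /b mulrC mulKf.
  have -> : a / e = det (T t) (q - sigma t) by rewrite /a mulrC mulKf.
  by rewrite /det/= /GRing.scale/=; field.
by rewrite (_ : _ + _ = 0) ?mul0r//; ring.
Qed.

End Tangents.

Section Sides.
Context {R : realType}.
Variables (K : set (R * R)) (sigma : R -> R * R) (e : R).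
Hypothesis oK : open K.
Hypothesis K_boundary : boundary K = range sigma.
Hypothesis inner : forall t p, K p -> 0 < e * det (derive1 sigma t) (p - sigma t).
Let T := derive1 sigma.

Lemma closure_halfplane t p : closure K p -> 0 <= e * det (T t) (p - sigma t).
Proof.
pose f q := e * det (T t) (q - sigma t).
have cf : continuous f.
  move=> q; apply: cvgM; first exact: cvg_cst.
  by apply: cvgB; apply: cvgM; try exact: cvg_cst; apply: cvgB;
    try exact: cvg_cst; [exact: cvg_snd|exact: cvg_fst].
have clf : closed (f @^-1` [set y | 0 <= y]).
  by apply: preimage_closed; [move=> q _; exact: cf|exact: closed_ge].
move=> Kp; suff : closure (f @^-1` [set y | 0 <= y]) p.
  by rewrite -((closure_id _).1 clf).
by apply: closureS Kp => q Kq; rewrite /= /f ltW// inner.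
Qed.

(** If [x] is outside the closure, the segment from a point [q] of [K] to [x]
    leaves the closure at some [sigma t] strictly before [x].  Heights above the
    tangent at [t] are affine along the segment, positive at [q] and zero at
    [sigma t], hence negative at [x]. *)
Lemma closure_of_halfplanes x : K !=set0 ->
  (forall t, 0 <= e * det (T t) (x - sigma t)) -> closure K x.
Proof.
move=> [q Kq] Hx.
pose f (u : R) := q + u *: (x - q).
have cf : continuous f.
  move=> u; apply: cvgD; first exact: cvg_cst.
  by apply: cvgZl; exact: cvg_id.
(* The last parameter at which the segment is in the closure. *)
pose A := [set u : R | 0 <= u <= 1 /\ closure K (f u)].
have A0 : A 0 by split; [rewrite lexx ler01|rewrite /f scale0r addr0; exact: subset_closure].
have Aub : ubound A 1 by move=> u [/andP[]].
have clA : closed A.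
  have -> : A = [set u | 0 <= u] `&` [set u | u <= 1] `&` f @^-1` closure K.
    apply/seteqP; split=> [u [/andP[u0 u1] fu]|u [[u0 u1] fu]]; first by [].
    by split; first exact/andP.
  apply: closedI; first by apply: closedI; [exact: closed_ge|exact: closed_le].
  by apply: preimage_closed; [move=> u _; exact: cf|exact: closed_closure].
have [/andP[v0 v1] fv] : A (sup A).
  suff : closure A (sup A) by rewrite -((closure_id A).1 clA).
  by apply: closure_sup; [exists 0|exists 1].
set v := sup A in v0 v1 fv.
have [v_eq1|v_neq1] := eqVneq v 1.
  by move: fv; rewrite v_eq1 /f scale1r addrC subrK.
have {}v1 : v < 1 by rewrite lt_neqAle v_neq1.
have nKv : ~ K (f v).
  move=> Kv; have /nbhs_ballP[d /= d0 Hd] : \forall u \near v, K (f u).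
    by apply: cf; apply: open_nbhs_nbhs.
  pose w := Num.min 1 (v + d / 2).
  have vw : v < w by rewrite lt_min v1 ltrDl divr_gt0.
  have wd : w <= v + d / 2 by rewrite ge_min lexx orbT.
  have w1 : w <= 1 by rewrite ge_min lexx.
  have : A w.
    split; first by rewrite w1 (le_trans v0 (ltW vw)).
    apply: subset_closure; apply: Hd; rewrite /ball/= ltr0_norm ?subr_lt0//; lra.
  by move/(ub_le_sup (ex_intro _ 1 Aub)); rewrite leNgt vw.
have [t _ st] : range sigma (f v).
  by rewrite -K_boundary; split=> //; rewrite (interior_id K).1.
have := inner t Kq; have := Hx t.
have -> : det (T t) (q - sigma t) = - (v * det (T t) (x - q)).
  by rewrite st /f /det/= /GRing.scale/=; ring.
have -> : det (T t) (x - sigma t) = (1 - v) * det (T t) (x - q).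
  by rewrite st /f /det/= /GRing.scale/=; ring.
rewrite mulrCA pmulr_rge0 ?subr_gt0// => D0.
by rewrite mulrN [e * (v * _)]mulrCA oppr_gt0 ltNge mulr_ge0.
Qed.

End Sides.

(** * Curvature of a curve that lies on one side of its tangents *)
Section Frenet.
Context {R : realType}.
Variables (sigma T : R -> R * R) (e : R).
Hypothesis e2 : e ^+ 2 = 1.
Hypothesis dsigma : forall t : R, derivable sigma t 1.
Hypothesis sigma' : derive1 sigma = T.
Hypothesis unit_speed : forall t, (T t).1 ^+ 2 + (T t).2 ^+ 2 = 1.
Hypothesis support : forall s t, 0 <= e * det (T s) (sigma t - sigma s).
Let k t := e * det (T t) (derive1 T t).

(** A negative curvature at [s] would make the curve dip below its tangent at
    [s]: the height [h] has [h s = h' s = 0] and [h'' s = k s]. *)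
Lemma curvature_ge0 (s : R) : derivable T s 1 -> 0 <= k s.
Proof.
move=> dT; rewrite leNgt; apply/negP => ks.
pose h u := e * det (T s) (sigma u - sigma s).
pose h' u := e * det (T s) (T u).
have dh (u : R) : is_derive u 1 h (h' u).
  have dd := is_derive_det (T s) (@dsigma u); rewrite sigma' in dd.
  have -> : h = e *: ((fun u => det (T s) (sigma u)) - cst (det (T s) (sigma s))).
    by apply/funext => z; rewrite /h det_sub.
  by apply: is_derive_eq; rewrite subr0.
have dh' : is_derive s 1 h' (k s).
  have dd := is_derive_det (T s) dT.
  have -> : h' = e *: (fun u => det (T s) (T u)) by [].
  by apply: is_derive_eq.
have h's : h' s = 0 by rewrite /h' /det; ring.
have cvq : x^-1 *: ((h' \o shift s) (x *: 1) - h' s) @[x --> 0^'] --> k s.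
  by have [dq <-] := dh'; exact: dq.
have /nbhs_ballP[d /= d0 Hd] : \forall x \near 0^', x^-1 *: ((h' \o shift s) (x *: 1) - h' s) < 0.
  by exact: (cvgr_lt _ cvq _ ks).
have h'neg x : s < x < s + d -> h' x < 0.
  move=> /andP[sx xd].
  have xs0 : 0 < x - s by rewrite subr_gt0.
  have bx : ball (0 : R) d (x - s).
    by rewrite -ball_normE /= sub0r normrN gtr0_norm// ltrBlDl.
  have : (x - s)^-1 * (h' ((x - s) * 1 + s) - h' s) < 0.
    exact: Hd bx (lt0r_neq0 xs0).
  rewrite mulr1 h's subr0 subrK.
  by rewrite pmulr_rlt0 // invr_gt0.
have ss : s < s + d / 2 by rewrite ltrDl divr_gt0.
have [|c] := @MVT _ h h' s (s + d / 2) ss (fun x _ => dh x).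
  apply: continuous_subspaceT => x; apply: differentiable_continuous.
  by apply/derivable1_diffP; have := dh x => -[].
rewrite in_itv/= => /andP[sc cd] hE.
have := support s (s + d / 2); rewrite -/(h _).
have -> : h (s + d / 2) = h' c * (d / 2).
  rewrite -[LHS]subr0 -[X in _ - X](_ : h s = 0); last by rewrite /h subrr /det/=; ring.
  by rewrite hE addrC addKr.
have d20 : 0 < d / 2 by rewrite divr_gt0.
have dd : d / 2 < d by rewrite ltr_pdivrMr// ltr_pMr// ltr1n.
have h'c : h' c < 0 by apply: h'neg; rewrite sc (lt_trans cd)// ltrD2l.
by rewrite leNgt nmulr_rlt0 ?d20.
Qed.

(** The first Frenet equation, obtained by differentiating the relation
    [|T|^2 = 1]. *)
Lemma frenet_frame (t : R) : derivable T t 1 ->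
  derive1 T t = (- (e * k t * (T t).2), e * k t * (T t).1).
Proof.
move=> dT.
have d1 := is_derive_fst dT; have d2 := is_derive_snd dT.
have dsum := is_deriveD (is_deriveM d1 d1) (is_deriveM d2 d2).
have c1 : (fst \o T) * (fst \o T) + (snd \o T) * (snd \o T) = cst 1.
  by apply/funext => u; rewrite -(unit_speed u) !expr2.
have := @derive_val _ _ _ _ _ _ _ dsum; rewrite c1 derive_cst.
have ek : e * k t = det (T t) (derive1 T t) by rewrite /k mulrA -expr2 e2 mul1r.
move=> o1; have [a'E b'E] := unit_vector_derivative (unit_speed t) (esym o1).
by rewrite ek; apply: injective_projections.
Qed.

Lemma curvature_le (t kappa : R) : enorm (derive1 T t) <= kappa -> k t <= kappa.
Proof.
move=> Tk; apply: (le_trans (ler_norm _)); apply: det_bound => //.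
exact: le_trans (sqrtr_ge0 _) Tk.
Qed.

End Frenet.

(** * Periodicity and break points *)
Section Periodic.
Context {R : realType} {V : normedModType R}.
Implicit Types (f : R -> V) (L : R).

Lemma periodic_int f L (n : int) (t : R) : (forall u, f (u + L) = f u) ->
  f (t + n%:~R * L) = f t.
Proof.
move=> fL; have fN (m : nat) u : f (u + m%:R * L) = f u.
  elim: m u => [|m IH] u; first by rewrite mul0r addr0.
  by rewrite -natr1 mulrDl mul1r addrA fL IH.
case: n => m; first exact: fN.
by rewrite NegzE mulrNz mulNr -{2}(subrK (m.+1%:R * L) t) fN.
Qed.

Lemma periodic_shift f L (t : R) : (forall u, f (u + L) = f u) ->
  f \o shift (t + L) = f \o shift t.
Proof. by move=> fL; apply/funext => u; rewrite /= addrA fL. Qed.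

Lemma periodic_derive1 f L : (forall u, f (u + L) = f u) ->
  forall t, derive1 f (t + L) = derive1 f t.
Proof.
by move=> fL t; rewrite !derive1E /derive periodic_shift// fL.
Qed.

Lemma periodic_derivable f L (t : R) : (forall u, f (u + L) = f u) ->
  derivable f t 1 -> derivable f (t + L) 1.
Proof. by move=> fL; rewrite /derivable periodic_shift// fL. Qed.

End Periodic.

Section Pieces.
Context {R : realType}.

Lemma period_representative (L s t : R) : 0 < L ->
  exists n : int, s <= t + n%:~R * L < s + L.
Proof.
move=> L0; exists (- Num.floor ((t - s) / L)).
have /andP[] := floor_itv ((t - s) / L); set n := Num.floor _.
rewrite intrD mulr1z ler_pdivlMr// ltr_pdivrMr// mulrDl mul1r mulrNz mulNr; lra.
Qed.

Lemma partition_piece (a b : R) (l : seq R) (t : R) : itv_partition a b l ->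
  a < t < b -> t \notin l ->
  exists2 i, (i < size l)%N & nth b (a :: l) i < t < nth b l i.
Proof.
elim: l a => [|x l IH] a ab /andP[at0 tb].
  by have := itv_partition_nil ab => E; move: (lt_trans at0 tb); rewrite E ltxx.
rewrite inE negb_or => /andP[tx tl].
have [ltx|] := ltP t x; first by exists 0%N => //=; rewrite at0.
rewrite le_eqVlt eq_sym (negbTE tx)/= => xt.
have [|i il it] := IH x (itv_partition_cons ab) _ tl; first by rewrite xt.
by exists i.+1.
Qed.

Lemma partition_last (a b : R) (l : seq R) : a < b -> itv_partition a b l -> b \in l.
Proof.
case: l => [|x l] ab; first by move/itv_partition_nil=> E; rewrite E ltxx in ab.
by case=> _ /= /eqP <-; exact: mem_last.
Qed.

(** A period starting at [s] meets two copies of the break points. *)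
Lemma piecewise_C2_derivable (f : R -> R * R) (L s : R) : 0 < L ->
  (forall t, f (t + L) = f t) -> piecewise_C2 f 0 L -> 0 <= s < L ->
  exists l : seq R, forall t, s < t < s + L -> t \notin l ->
    derivable (derive1 f) t 1.
Proof.
move=> L0 fL [l lp lC2] /andP[s0 sL].
have good t : 0 < t < L -> t \notin l -> derivable (derive1 f) t 1.
  move=> t0L tl; have [i il it] := partition_piece lp t0L tl.
  have [_ d2 _ _ _] := lC2 i il.
  by have [|_] := d2 t; first by rewrite in_itv.
exists (l ++ [seq x + L | x <- l]) => t /andP[st tsL].
rewrite mem_cat negb_or => /andP[tl tl'].
have [tL|tL|tL] := ltgtP t L.
- by apply: good => //; rewrite tL (le_lt_trans s0).
- rewrite -(subrK L t); apply: periodic_derivable; first exact: periodic_derive1.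
  apply: good; first by apply/andP; split; lra.
  by apply: contra tl' => tl'; apply/mapP; exists (t - L); rewrite ?subrK.
- by move: tl; rewrite tL (partition_last L0 lp).
Qed.

End Pieces.

(** * Heights above the tangents of a constrained loop *)
Section Support.
Context {R : realType}.
Variables (sigma T : R -> R * R) (e L kappa : R).
Hypothesis kappa_gt0 : 0 < kappa.
Hypothesis sigma' : derive1 sigma = T.
Hypothesis sigma_constrained : constrained_loop kappa sigma L.
Hypothesis e2 : e ^+ 2 = 1.
Hypothesis support : forall s t, 0 <= e * det (T s) (sigma t - sigma s).

Lemma unit_tangent t : (T t).1 ^+ 2 + (T t).2 ^+ 2 = 1.
Proof.
have [[_ _ _ _ _ u1 _] _ _] := sigma_constrained.
by rewrite -[LHS]sqr_sqrtr ?addr_ge0 ?sqr_ge0// -/(enorm _) -sigma' u1 expr1n.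
Qed.

(** The height above the tangent at [s] grows at least as for a circle of radius
    [1 / kappa].  Both sides are periodic in [s] and in [t], so [t] may be taken
    in the period that starts at [s], where [support_ge_chord] applies. *)
Lemma support_chord s t :
  kappa^-1 * (1 - ((T s).1 * (T t).1 + (T s).2 * (T t).2)) <=
  e * det (T s) (sigma t - sigma s).
Proof.
have [[L0 sL _ ds cT _ _] pC2 curv] := sigma_constrained.
have TL u : T (u + L) = T u by rewrite -sigma' periodic_derive1.
rewrite sigma' in cT.
wlog s0L : s / 0 <= s < L.
  move=> H; have [n] := period_representative 0 s L0; rewrite add0r => sn.
  by have := H _ sn; rewrite !periodic_int.
wlog tsL : t / s <= t < s + L.
  by move=> H; have [n tn] := period_representative s t L0; have := H _ tn; rewrite !periodic_int.
have [l] := piecewise_C2_derivable L0 sL pC2 s0L; rewrite sigma' => bad.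
(* The scalar product with T s, as the determinant with T s rotated by -pi/2. *)
pose dot u := det ((T s).2, - (T s).1) (T u).
have dotE u : dot u = (T s).1 * (T u).1 + (T s).2 * (T u).2 by rewrite /dot /det/=; ring.
rewrite -dotE.
pose g u := e * det (T s) (sigma u - sigma s).
pose phi u := e * det (T s) (T u).
have cphi : continuous phi.
  by move=> u; apply: cvgM; [exact: cvg_cst|exact: det_continuous].
have cdot : continuous dot by exact: det_continuous.
have dg (u : R) : is_derive u 1 g (phi u).
  have dd := is_derive_det (T s) (ds u); rewrite sigma' in dd.
  have -> : g = e *: ((fun u => det (T s) (sigma u)) - cst (det (T s) (sigma s))).
    by apply/funext => z; rewrite /g det_sub.
  by apply: is_derive_eq; rewrite subr0.
have uT u := unit_tangent u.
have dotTs : dot s = 1 by rewrite dotE -!expr2 uT.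
apply: (@support_ge_chord R g phi dot (fun u => e * det (T u) (derive1 T u)) l s (s + L)) => //.
- move=> u usL ul; have dT := bad u usL ul.
  have Tu := frenet_frame e2 uT dT.
  set ku := e * det (T u) (derive1 T u).
  split.
  + apply: is_derive_eq (is_deriveZ e (is_derive_det (T s) dT)) _.
    rewrite [derive1 T u]Tu -/ku dotE /det /GRing.scale/=.
    transitivity (e ^+ 2 * (ku * ((T s).1 * (T u).1 + (T s).2 * (T u).2))).
      by ring.
    by rewrite e2 mul1r.
  + apply: is_derive_eq (is_derive_det _ dT) _.
    by rewrite [derive1 T u]Tu -/ku /phi /det/=; ring.
  + rewrite (curvature_ge0 ds sigma' support dT)/=.
    by apply: (curvature_le e2 uT); have := curv u; rewrite /= sigma'; exact.
- move=> u; rewrite dotE /phi exprMn e2 mul1r -[RHS](mulr1 1) -{1}(uT s) -(uT u) /det.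
  by ring.
- by move=> u; exact: support.
- by rewrite dotE TL -!expr2 uT.
- by case/andP: tsL => -> /ltW.
Qed.

End Support.

(** * Rolling *)
Theorem theorem2p23 (R : realType) (kappa : R) (kappa_gt0 : 0 < kappa)
    (K : set (R * R)) (sigma : R -> R * R) (L : R)
    (K_domain : planar_domain K) (K_convex : convex_set K)
    (sigma_constrained : constrained_loop kappa sigma L)
    (K_boundary : boundary K = range sigma) :
  rolling kappa sigma K.
Proof.
have [oK _] := K_domain.
have [[_ _ _ ds cT _ _] _ _] := sigma_constrained.
have u1 := unit_tangent erefl sigma_constrained.
have [e e2 inner] := inner_side oK K_convex K_boundary ds u1 cT.
have clK t := closure_halfplane inner t.
have support s t : 0 <= e * det (derive1 sigma s) (sigma t - sigma s).
  by apply: clK; exact: curve_closure.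
have chord := support_chord kappa_gt0 erefl sigma_constrained e2 support.
have [T TE] : exists T, derive1 sigma = T by exists (derive1 sigma).
have r0 : 0 <= kappa^-1 by rewrite invr_ge0 ltW.
rewrite TE in u1 chord.
have halfplanes := closure_of_halfplanes oK K_boundary inner.
rewrite TE in inner halfplanes.
rewrite /rolling /internal_rolling /external_rolling /tangent_line TE.
split=> t.
- exists (sigma t + (e * kappa^-1) *: (- (T t).2, (T t).1)) => /=.
  split; first by apply: disk_tangent => //; rewrite exprMn e2 mul1r.
  move=> q qD; apply: halfplanes.
    exact: domain_nonempty K_boundary.
  (* By chord the centre has height at least 1 / kappa above the tangent at s,
     and a point of the disk is lower by at most 1 / kappa. *)
  move=> s; have := chord s t.
  have := det_bound r0 e2 (u1 s) qD; rewrite ler_norml => /andP[+ _].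
  rewrite !det_sub.
  have -> : det (T s) (sigma t + (e * kappa^-1) *: (- (T t).2, (T t).1)) =
      det (T s) (sigma t) + e * (kappa^-1 * ((T s).1 * (T t).1 + (T s).2 * (T t).2)).
    by rewrite /det/= /GRing.scale/=; ring.
  set d := kappa^-1 * _; have -> : e * (det (T s) q - (det (T s) (sigma t) + e * d)) =
    e * (det (T s) q - det (T s) (sigma t)) - e ^+ 2 * d by ring.
  rewrite e2 mul1r [kappa^-1 * (1 - _)]mulrBr mulr1 -/d; lra.
- exists (sigma t + (- (e * kappa^-1)) *: (- (T t).2, (T t).1)) => /=.
  split; first by apply: disk_tangent => //; rewrite sqrrN exprMn e2 mul1r.
  (* The centre has height - 1 / kappa above the tangent at t. *)
  move=> q qE; apply: subset_closure => Kq; have := inner t q Kq.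
  have := det_bound r0 e2 (u1 t) qE; rewrite ler_norml => /andP[_].
  rewrite !det_sub.
  have -> : det (T t) (sigma t + (- (e * kappa^-1)) *: (- (T t).2, (T t).1)) =
      det (T t) (sigma t) - e * (kappa^-1 * ((T t).1 ^+ 2 + (T t).2 ^+ 2)).
    by rewrite /det/= /GRing.scale/=; ring.
  rewrite u1 mulr1.
  have -> : e * (det (T t) q - (det (T t) (sigma t) - e * kappa^-1)) =
    e * (det (T t) q - det (T t) (sigma t)) + e ^+ 2 * kappa^-1 by ring.
  rewrite e2 mul1r; lra.
Qed.
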